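(* Let $k\ge 2$ and $n$ be positive integers. If $\gcd(k,n)=1$, then for each $s\in\mathbb{Z}_n$, \[ m(k,n;s)=\max_{d\mid n}\left(\left\lfloor\frac{d-2}{k}\right\rfloor+1\right)\frac{n}{d}, \] where the maximum is over all positive divisors $d$ of $n$.
   Context: $\mathbb{Z}_n=\mathbb{Z}/n\mathbb{Z}$. For $B\subset\mathbb{Z}_n$, the $k$-fold sumset is $kB=\{b_1+\cdots+b_k: b_i\in B \text{ for } 1\le i\le k\}$ (repetitions allowed). For $s\in\mathbb{Z}_n$, $m(k,n;s)=\max\{|B|: B\subset\mathbb{Z}_n,\ s\notin kB\}$ (the empty set is allowed, with empty sumset). $\lfloor\cdot\rfloor$ is the floor function (so $\lfloor -1/k\rfloor=-1$). *)

(* Defs.v *)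
From HB Require Import structures.
From mathcomp Require Import all_boot all_order all_algebra.

Set Implicit Arguments.
Unset Strict Implicit.
Unset Printing Implicit Defensive.

Import Order.TTheory GRing.Theory Num.Theory.
Local Open Scope ring_scope.

(* Z/nZ for every n > 0: MathComp's 'Z_n is Z/2Z when n = 1, whereas 'I_p.+1
   is an additive group of order p.+1 for every p. *)
Definition Zmod (n : nat) : finZmodType := 'I_n.-1.+1.

Definition sumset (V : finZmodType) (k : nat) (B : {set V}) : {set V} :=
  [set \sum_i f i | f : {ffun 'I_k -> V} in ffun_on (mem B)].

Definition maxavoid (k n : nat) (s : Zmod n) : nat :=
  \max_(B : {set Zmod n} | s \notin sumset k B) #|B|.

(* divz by k > 0 rounds towards minus infinity, so the factor is 0 at d = 1. *)
Definition divisor_term (k n d : nat) : int :=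
  (((d%:Z - 2) %/ k%:Z)%Z + 1) * (n %/ d)%N%:Z.

(* For n > 0 the divisor d = 1 contributes the value 0, so the initial value 0
   does not alter the maximum. *)
Definition max_divisor_term (k n : nat) : int :=
  \big[Num.max/0]_(d <- divisors n) divisor_term k n d.

(* Main.v *)
Require Import Defs.
From HB Require Import structures.
From mathcomp Require Import all_boot all_order all_algebra.
From mathcomp Require Import all_fingroup cyclic zify.

Set Implicit Arguments.
Unset Strict Implicit.
Unset Printing Implicit Defensive.

Import Order.TTheory GRing.Theory Num.Theory.

(** Upper bound: let H be the stabilizer of kB. By Kneser's theorem, k times the
    number of cosets of H meeting B exceeds the number of those making up kB by
    at most k - 1, and since kB misses a point it misses a whole coset of H.
    With d the index of H, the set B thus meets at most floor((d - 2) / k) + 1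
    cosets of H. Kneser's theorem for two summands follows his own argument: by
    Dyson transforms, every point of A + B lies in some C contained in A + B
    with |C| + |stab C| >= |A| + |B|, and unions inherit this inequality.
    Lower bound: k being invertible modulo n, translating B moves the avoided
    point s anywhere; so, for d dividing n, s may be taken to be d - 1, which is
    avoided by the preimage of an interval of floor((d - 2) / k) + 1 residues
    modulo d starting from 0. *)

Lemma cardsUD (T : finType) (A B : {set T}) : #|A :|: B| = #|A| + #|B :\: A|.
Proof. by rewrite -(cardsID A (A :|: B)) setUK setDUl setDv set0U. Qed.

Section RightStabilizer.

Local Open Scope group_scope.

Variable gT : finGroupType.
Implicit Types (A B C D E S T : {set gT}) (G H K L : {group gT}).

Lemma sub_astabsR A B : (B \subset 'N(A | 'R)) = (A * B \subset A).
Proof.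
apply/subsetP/subsetP=> [nAB _ /mulsgP[a b aA /nAB nAb ->] | sAB b bB].
  by rewrite (astabs_act a nAb).
by rewrite !inE; apply/subsetP=> a aA; rewrite inE; apply/sAB/mem_mulg.
Qed.

Lemma astabsR_mulg A B : 'N(B | 'R) \subset 'N(A * B | 'R).
Proof. by rewrite sub_astabsR -mulgA mulgS // -sub_astabsR. Qed.

Lemma astabsR_rcoset A B b :
  b \in 'C(B) -> B \subset 'N(A | 'R) -> B \subset 'N(A :* b | 'R).
Proof.
move=> cBb; rewrite !sub_astabsR => sABA.
by rewrite -mulgA (centC (A := [set b])) ?sub1set // mulgA mulSg.
Qed.

Lemma mulG_astabsR G A : [acts G, on A | 'R] -> A * G = A.
Proof.
by rewrite sub_astabsR => sAG; apply/eqP; rewrite eqEsubset sAG mulG_subl.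
Qed.

Lemma leq_card_actsR G A : [acts G, on A | 'R] -> A != set0 -> #|G| <= #|A|.
Proof.
move=> nAG /set0Pn[a aA].
by rewrite -(card_lcoset G a) -orbitR subset_leq_card // acts_sub_orbit.
Qed.

Lemma Lagrange_mulg A G : (#|A : G| * #|G|)%N = #|G * A|.
Proof.
rewrite -indexMg -[RHS]sum1_card (partition_big_imset (rcoset G)) /=.
rewrite -sum_nat_const; apply: eq_bigr => _ /rcosetsP[x xGA ->].
have {xGA}[g a gG aA ->] := mulsgP xGA.
rewrite -(card_rcoset _ (g * a)) -sum1_card; apply: eq_bigl => y.
rewrite rcosetE (sameP eqP rcoset_eqP) andb_idl // rcosetM rcoset_id //.
by apply/subsetP; rewrite mulgS ?sub1set.
Qed.

Lemma leq_muln_card_mulg H K S T :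
  S \subset H -> T \subset K -> #|S| * #|T| <= #|S * T| * #|H :&: K|.
Proof.
move=> /subsetP sSH /subsetP sTK; rewrite -cardsX -sum1_card.
pose mulp (p : gT * gT) := p.1 * p.2.
have mulpST p : p \in setX S T -> mulp p \in S * T.
  by case: p => s t /setXP[/= sS tT]; apply: mem_mulg.
rewrite (partition_big mulp [in S * T] mulpST) -sum_nat_const leq_sum //.
move=> _ /mulsgP[s0 t0 s0S t0T ->]; rewrite sum1_card -(card_lcoset _ s0).
have fst_inj : {in [pred p in setX S T | mulp p == s0 * t0] &, injective fst}.
  move=> [s t] [s' t'] /andP[_ /eqP /= Est] /andP[_ /eqP /= Est'] /= Es.
  by move: Est; rewrite -Est' /mulp /= Es => /mulgI ->.
rewrite -(card_in_imset fst_inj); apply/subset_leq_card/subsetP=> x.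
case/imsetP=> -[s t] /andP[/setXP[/= sS tT] /eqP Est] ->.
rewrite mem_lcoset inE groupM ?groupV ?sSH //=.
by rewrite -(mulgK t s) [s * t]Est mulgA mulKg groupM ?groupV ?sTK.
Qed.

Lemma leq_addn_card_mulg H K S T :
    S \subset H -> T \subset K -> S != set0 -> T != set0 ->
    [acts H :&: K, on S | 'R] -> [acts H :&: K, on T | 'R] ->
  #|S| + #|T| <= #|S * T| + #|H :&: K|.
Proof.
move=> sSH sTK S0 T0 nS nT.
have := leq_card_actsR nS S0; have := leq_card_actsR nT T0.
have := leq_muln_card_mulg sSH sTK; have := cardG_gt0 (H :&: K)%G; rewrite /=.
(* Expand (#|S| - l) * (#|T| - l) >= 0, where l = #|H :&: K|. *)
move: #|_ :&: _| #|S| #|T| #|S * T| => l a b c; nia.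
Qed.

Lemma leq_card_setI_setD H K C D :
    K \subset 'C(H) -> [acts H, on C | 'R] -> [acts K, on D | 'R] ->
    H :&: D != set0 -> K :\: C != set0 ->
  #|H :&: D| + #|K :\: C| <= #|D :\: C| + #|H :&: K|.
Proof.
move=> cHK nCH nDK HD0 KC0.
have nHDL : [acts H :&: K, on H :&: D | 'R].
  by rewrite actsI ?astabsR ?subsetIl // (subset_trans (subsetIr H K)).
have nKCL : [acts H :&: K, on K :\: C | 'R].
  by rewrite actsD ?astabsR ?subsetIr // (subset_trans (subsetIl H K)).
have := leq_addn_card_mulg (subsetIl H D) (subsetDl K C) HD0 KC0 nHDL nKCL.
move/leq_trans; apply; rewrite leq_add2r subset_leq_card //.
apply/subsetP=> _ /mulsgP[h k /setIP[hH hD] /setDP[kK kC] ->].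
rewrite inE (acts_act nDK kK) hD andbT.
by have /= <- := centsP cHK k kK h hH; rewrite (acts_act nCH hH).
Qed.

(* Translate so that 1 \in D :\: C. Then D :\: C contains (H :&: D) * (K :\: C),
   and C :\: D contains (K :&: C) * (H :\: D); one of them is large enough. *)
Lemma leq_card_setU_acts H K C D :
    K \subset 'C(H) -> [acts H, on C | 'R] -> [acts K, on D | 'R] ->
    ~~ (D \subset C) -> #|H| <= #|K| ->
  (#|C| + #|H| <= #|C :|: D| + #|H :&: K|)
  || (#|D| + #|K| <= #|C :|: D| + #|H :&: K|).
Proof.
move=> cHK nCH nDK /subsetPn[c cD cC] leHK.
wlog c1 : c C D nCH nDK cD cC / c = 1.
  have nR L E : [acts L, on E | 'R] -> [acts L, on c^-1 *: E | 'R].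
    by move/subset_trans; apply; apply: astabsR_mulg.
  move/(_ 1 (c^-1 *: C) (c^-1 *: D)); rewrite -mulgU !card_lcoset.
  by apply; rewrite ?nR // mem_lcoset invgK mulg1.
have cardH : #|H :&: D| + #|H :\: D| = #|H| := cardsID D H.
have cardK : #|K :&: C| + #|K :\: C| = #|K| := cardsID C K.
have cardUC : #|C :|: D| = #|C| + #|D :\: C| := cardsUD C D.
have cardUD : #|C :|: D| = #|D| + #|C :\: D| by rewrite setUC; apply: cardsUD.
have HD0 : H :&: D != set0.
  by apply/set0Pn; exists 1; rewrite inE group1 -c1.
have KC0 : K :\: C != set0.
  by apply/set0Pn; exists 1; rewrite inE group1 -c1 cC.
have le_DC := leq_card_setI_setD cHK nCH nDK HD0 KC0.
have [leHD_KC | ltKC_HD] := leqP #|H :\: D| #|K :\: C|.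
  by apply/orP; left; lia.
have KC'0 : K :&: C != set0 by rewrite -card_gt0; lia.
have HD'0 : H :\: D != set0 by rewrite -card_gt0; lia.
have := leq_card_setI_setD _ nDK nCH KC'0 HD'0.
by rewrite centsC (setIC K H) => /(_ cHK) le_CD; apply/orP; right; lia.
Qed.

End RightStabilizer.

Section Kneser.

Local Open Scope group_scope.

Variable gT : finGroupType.
Implicit Types (A B C D : {set gT}) (G : {group gT}).

Lemma kneser_setU G C D m :
    abelian G ->
    m <= #|C| + #|'N_G(C | 'R)| -> m <= #|D| + #|'N_G(D | 'R)| ->
  m <= #|C :|: D| + #|'N_G(C :|: D | 'R)|.
Proof.
move=> cGG; wlog leCD : C D / #|'N_G(C | 'R)| <= #|'N_G(D | 'R)|.
  move=> wlogCD mC mD.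
  have [leCD | /ltnW leDC] := leqP #|'N_G(C | 'R)| #|'N_G(D | 'R)|.
    exact: wlogCD.
  by rewrite setUC wlogCD.
move=> mC mD; have [/setUidPl -> // | nsDC] := boolP (D \subset C).
set H := 'N_G(C | 'R)%G in leCD mC; set K := 'N_G(D | 'R)%G in leCD mD.
have nCH : [acts H, on C | 'R] := subsetIr _ _.
have nDK : [acts K, on D | 'R] := subsetIr _ _.
have cHK : K \subset 'C(H) by rewrite (sub_abelian_cent2 cGG) ?subsetIl.
have leHK : #|H :&: K| <= #|'N_G(C :|: D | 'R)|.
  rewrite subset_leq_card // subsetI subIset ?subsetIl //=.
  exact: subset_trans (setISS nCH nDK) (astabsU _ _ _).
have [leU | leU] := orP (leq_card_setU_acts cHK nCH nDK nsDC leCD).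
  by rewrite (leq_trans mC) // (leq_trans leU) // leq_add2l.
by rewrite (leq_trans mD) // (leq_trans leU) // leq_add2l.
Qed.

Definition dyson_add A B e := A :|: B :* e.
Definition dyson_sub A B e := B :&: A :* e^-1.

Lemma card_dyson A B e : #|dyson_add A B e| + #|dyson_sub A B e| = #|A| + #|B|.
Proof.
rewrite -(card_rcoset B e) -(cardsUI A) -(card_rcoset (dyson_sub A B e) e).
congr (_ + _); apply: eq_card => z.
by rewrite mem_rcoset !inE !mem_rcoset invgK mulgKV andbC.
Qed.

Lemma dyson_mulg_subset A B e :
    B \subset 'C(A) -> e \in 'C(A) ->
  dyson_add A B e * dyson_sub A B e \subset A * B.
Proof.
move=> cAB cAe; apply/subsetP=> _ /mulsgP[x y xA /setIP[yB yA] ->].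
case/setUP: xA => [xA | /rcosetP[z zB ->]]; first exact: mem_mulg.
case/rcosetP: yA => a aA ->.
rewrite mulgA -(mulgA z) (centP cAe a aA) mulgA mulgK (centsP cAB) //.
exact: mem_mulg.
Qed.

Lemma kneser_mem G A B a b :
    abelian G -> A \subset G -> B \subset G -> a \in A -> b \in B ->
  exists C, [/\ a * b \in C, C \subset A * B
              & #|A| + #|B| <= #|C| + #|'N_G(C | 'R)|].
Proof.
move=> cGG; have [n] := ubnP #|B|; elim: n A B => // n IH A B ltB sAG sBG aA bB.
have bG := subsetP sBG b bB.
have [sABb | ] := boolP (A * (B :* b^-1) \subset A).
  have sBbG : B :* b^-1 \subset G by rewrite mul_subG ?sub1set ?groupV.
  exists (A :* b); split; first by rewrite mem_rcoset mulgK.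
    by rewrite mulgS ?sub1set.
  rewrite card_rcoset leq_add2l -(card_rcoset B b^-1) subset_leq_card //.
  rewrite subsetI sBbG astabsR_rcoset ?sub_astabsR //.
  exact: subsetP (sub_abelian_cent cGG sBbG) b bG.
case/subsetPn=> _ /mulsgP[x _ xA /rcosetP[y yB ->] ->] xyA.
have [xG yG] := (subsetP sAG x xA, subsetP sBG y yB).
pose e := b^-1 * x; have eG : e \in G by rewrite groupM ?groupV.
have sBG' : dyson_sub A B e \subset G := subset_trans (subsetIl _ _) sBG.
have sAG' : dyson_add A B e \subset G by rewrite subUset sAG mul_subG ?sub1set.
have aA' : a \in dyson_add A B e by rewrite inE aA.
have bB' : b \in dyson_sub A B e by rewrite inE bB mem_rcoset invgK mulKVg.
have ltB' : #|dyson_sub A B e| < #|B|.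
  apply/proper_card/properP; split; first exact: subsetIl.
  exists y => //; apply: contra xyA; rewrite inE mem_rcoset invgK => /andP[_].
  by rewrite (centsP cGG x xG) ?groupM ?groupV // mulgA.
have [C [abC sC leC]] := IH _ _ (leq_trans ltB' ltB) sAG' sBG' aA' bB'.
exists C; split; rewrite -?(card_dyson A B e) //.
apply: subset_trans sC (dyson_mulg_subset _ _).
  exact: sub_abelian_cent2 cGG sBG sAG.
exact: subsetP (sub_abelian_cent cGG sAG) e eG.
Qed.

Theorem kneser G A B :
    abelian G -> A \subset G -> B \subset G -> A != set0 -> B != set0 ->
  #|A| + #|B| <= #|A * B| + #|'N_G(A * B | 'R)|.
Proof.
move=> cGG sAG sBG /set0Pn[a aA] /set0Pn[b bB].
pose P C := (C \subset A * B) && (#|A| + #|B| <= #|C| + #|'N_G(C | 'R)|).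
have [C0 [_ sC0 leC0]] := kneser_mem cGG sAG sBG aA bB.
have [|C /maxsetP[/andP[sC leC] maxC] _] := @maxset_exists _ P C0.
  exact/andP.
suff <- : C = A * B by [].
apply/eqP; rewrite eqEsubset sC; apply/subsetP=> _ /mulsgP[x y xA yB ->].
have [D [xyD sD leD]] := kneser_mem cGG sAG sBG xA yB.
rewrite -(maxC (C :|: D)) ?subsetUl //; first by rewrite inE xyD orbT.
by rewrite /P subUset sC sD kneser_setU.
Qed.

Lemma kneser_expg G B k : abelian G -> B \subset G -> B != set0 ->
  k.+1 * #|B| <= #|B ^+ k.+1| + k * #|'N_G(B ^+ k.+1 | 'R)|.
Proof.
move=> cGG sBG B0; elim: k => [|k IH]; first by rewrite expg1 mul1n mul0n addn0.
have sXG : B ^+ k.+1 \subset G.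
  by elim: (k) => [|j IHj]; rewrite ?expg1 // expgS mul_subG.
have X0 : B ^+ k.+1 != set0.
  case/set0Pn: B0 => b bB; apply/set0Pn; exists (b ^+ k.+1).
  by elim: (k.+1) => [|j IHj]; rewrite ?inE // expgS [B ^+ _]expgS mem_mulg.
have leN : #|'N_G(B ^+ k.+1 | 'R)| <= #|'N_G(B ^+ k.+2 | 'R)|.
  by rewrite subset_leq_card // setIS // [B ^+ k.+2]expgS astabsR_mulg.
have := kneser cGG sBG sXG B0 X0; rewrite -expgS.
move: leN IH; move: #|B| #|B ^+ _| #|B ^+ _| #|_ :&: _| #|_ :&: _|.
by move=> b x y h h'; nia.
Qed.

Lemma leq_index_expg_proper G B k (H := 'N_G(B ^+ k.+1 | 'R)%G) :
    abelian G -> B \subset G -> B != set0 -> B ^+ k.+1 \proper G ->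
  k.+1 * #|B : H| + 2 <= #|G : H| + k.+1.
Proof.
move=> cGG sBG B0 /properP[sXG [g gG gX]].
have sHG : H \subset G := subsetIl _ _.
have nXH : [acts H, on B ^+ k.+1 | 'R] := subsetIr _ _.
have comm A : A \subset G -> commute H A.
  by move=> sAG; apply/centC/(sub_abelian_cent2 cGG).
have HX j : (H : {set gT}) ^+ j.+1 = H.
  by elim: j => [|j IHj]; rewrite ?expg1 // expgS IHj mulGid.
have eX : (H * B) ^+ k.+1 = B ^+ k.+1.
  by rewrite expgMn ?HX; [rewrite comm // mulG_astabsR | apply: comm].
have HB0 : H * B != set0.
  case/set0Pn: B0 => b bB; apply/set0Pn; exists b.
  exact: subsetP (mulG_subr H B) b bB.
have leD : #|H| <= #|G :\: B ^+ k.+1|.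
  apply: leq_card_actsR; first by rewrite actsD // astabsR.
  by apply/set0Pn; exists g; rewrite inE gX.
have cardX : (#|B ^+ k.+1| + #|G :\: B ^+ k.+1| = #|H| * #|G : H|)%N.
  by rewrite Lagrange // -{1}(setIidPr sXG) cardsID.
have := kneser_expg k cGG (mul_subG sHG sBG) HB0.
rewrite eX -/H -Lagrange_mulg -(leq_pmul2r (n2 := _ + k.+1) (cardG_gt0 H)).
move: leD cardX; move: #|_ :\: _| #|B ^+ _| #|H| #|_ : _| #|_ : _|.
by move=> u v h i j; nia.
Qed.

End Kneser.

(* For k, d > 0 this is floor((d - 2) / k) + 1; adding k first keeps d - 2 from
   being truncated at d = 1. *)
Definition max_coset_count (k d : nat) : nat := (d + k - 2) %/ k.

Lemma leq_max_coset_count k d b : 0 < k -> 0 < d ->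
  (b <= max_coset_count k d) = (k * b + 2 <= d + k).
Proof. by move=> k_gt0 d_gt0; rewrite leq_divRL // mulnC; lia. Qed.

Section Sumset.

Local Open Scope group_scope.

Variable V : finZmodType.
Implicit Types (B : {set V}) (s t : V).

Lemma sumset_expg B k : sumset k B = B ^+ k.
Proof.
rewrite -[in RHS](card_ord k) -prodg_const.
apply/setP=> x; apply/imsetP/prodsgP=> [[f /ffun_onP fB ->] | [c cB ->]].
  by exists f.
exists [ffun i => c i]; first by apply/ffun_onP=> i; rewrite ffunE cB.
by apply: eq_bigr => i _; rewrite ffunE.
Qed.

Lemma leq_card_avoiding B k s : (0 < k)%N -> s \notin sumset k B ->
  exists2 d, (d %| #|V|)%N & (#|B| <= max_coset_count k d * (#|V| %/ d))%N.
Proof.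
case: k => // k _; rewrite sumset_expg => sB.
have [-> | B0] := eqVneq B set0; first by exists 1%N; rewrite ?dvd1n ?cards0.
pose H := 'N_[set: V](B ^+ k.+1 | 'R)%G.
have sHV : H \subset [set: V] := subsetT _.
have ltBV : B ^+ k.+1 \proper [set: V].
  by rewrite properT; apply: contraNneq sB => ->; rewrite inE.
have leBH := leq_index_expg_proper (FinRing.zmod_abelian _) (subsetT B) B0 ltBV.
exists #|[set: V] : H|; rewrite -cardsT; first exact: dvdn_indexg.
rewrite divg_indexS //.
apply: leq_trans (subset_leq_card (mulG_subr H B)) _.
by rewrite -Lagrange_mulg leq_mul // leq_max_coset_count ?indexg_gt0.
Qed.

Lemma sumset_rcosetMn B k s t :
  ((s + t *+ k)%R \in sumset k (B :* t)) = (s \in sumset k B).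
Proof.
have cV (X Y : {set V}) : commute X Y.
  exact/centC/(sub_abelian_cent2 (FinRing.zmod_abelian setT)).
have set1X j : [set t] ^+ j = [set t ^+ j].
  by elim: j => // j IHj; rewrite !expgS IHj mulg_set1.
rewrite !sumset_expg expgMn // set1X mem_rcoset.
by rewrite -FinRing.zmodXgE -FinRing.zmodMgE mulgK.
Qed.

End Sumset.

Lemma val_sum_modn p (I : finType) (f : I -> 'I_p.+1) :
  val (\sum_i f i)%R = \sum_i val (f i) %[mod p.+1].
Proof.
elim/big_rec2: _ => // i y x _ IH.
by rewrite /= modn_mod -modnDmr IH modnDmr.
Qed.

Section ModularSumset.

Variables (k n : nat).
Hypothesis n_gt0 : 0 < n.

Lemma card_Zmod : #|Zmod n| = n.
Proof. by rewrite card_ord prednK. Qed.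

Lemma maxavoidDMn (s t : Zmod n) : maxavoid k (s + t *+ k)%R = maxavoid k s.
Proof.
rewrite /maxavoid (reindex_inj (can_inj (rcosetK t))).
by apply: eq_big => B; rewrite ?sumset_rcosetMn ?card_rcoset.
Qed.

Lemma maxavoid_coprime (s s' : Zmod n) :
  coprime k n -> maxavoid k s = maxavoid k s'.
Proof.
move=> co_kn; pose t := ((s' - s) *+ expg_invn [set: Zmod n] k)%R.
suff tk : (t *+ k = s' - s)%R by rewrite -(maxavoidDMn s t) tk addrC subrK.
rewrite -mulrnA mulnC mulrnA -!FinRing.zmodXgE expgK ?inE //.
by rewrite cardsT card_Zmod coprime_sym.
Qed.

Definition small_residues (d b : nat) : {set Zmod n} :=
  [set x | val x %% d < b].

Lemma card_small_residues d b : d %| n -> b <= d ->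
  #|small_residues d b| = b * (n %/ d).
Proof.
move=> dn le_bd; rewrite cardsE -sum1_card.
have count_block i :
    \sum_(i * d <= j < i.+1 * d) (if j %% d < b then 1 else 0) = b.
  rewrite -[in LHS](add0n (i * d)) big_addn mulSn addnK.
  rewrite -[RHS]muln1 -[in RHS](subn0 b) -sum_nat_const_nat.
  rewrite [RHS](big_nat_widen _ _ _ _ _ le_bd) [RHS]big_mkcond.
  apply: eq_big_nat => j /andP[_ lt_jd].
  by rewrite addnC modnMDl modn_small.
rewrite -(big_mkord (fun i => i %% d < b) (fun=> 1)) prednK //.
rewrite -[in index_iota _ _](divnK dn) big_mkcond big_nat_mul.
rewrite (eq_bigr _ (fun i _ => count_block i)).
by rewrite sum_nat_const_nat subn0 mulnC.
Qed.

Lemma notin_sumset_small_residues d b (s : Zmod n) :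
    d %| n -> k * b + 2 <= d + k -> val s %% d = d.-1 ->
  s \notin sumset k (small_residues d b).
Proof.
move=> dn le_kb sd; apply/imsetP=> -[f /ffun_onP fB def_s].
have d_gt0 := dvdn_gt0 n_gt0 dn.
have le_sum : \sum_(i < k) val (f i) %% d + k <= k * b.
  have : \sum_(i < k) (val (f i) %% d).+1 <= k * b.
    rewrite -[k in k * b]card_ord -sum_nat_const leq_sum // => i _.
    by have := fB i; rewrite inE.
  under eq_bigr do rewrite -addn1.
  by rewrite big_split sum_nat_const card_ord muln1.
have : \sum_(i < k) val (f i) %% d = d.-1 %[mod d].
  rewrite modn_summ -sd modn_mod def_s.
  have dn' : d %| n.-1.+1 by rewrite prednK.
  by rewrite -(modn_dvdm _ dn') -[RHS](modn_dvdm _ dn') val_sum_modn.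
rewrite !modn_small; lia.
Qed.

Lemma leq_maxavoid_divisor d (s : Zmod n) :
    0 < k -> coprime k n -> d %| n ->
  max_coset_count k d * (n %/ d) <= maxavoid k s.
Proof.
move=> k_gt0 co_kn dn; have d_gt0 := dvdn_gt0 n_gt0 dn.
have le_kb : k * max_coset_count k d + 2 <= d + k.
  by rewrite -leq_max_coset_count.
have ltdn : d.-1 < n.-1.+1 by rewrite !prednK // dvdn_leq.
pose r : Zmod n := Ordinal ltdn.
rewrite (maxavoid_coprime s r co_kn) -card_small_residues //; last by nia.
apply: leq_bigmax_cond; apply: notin_sumset_small_residues => //.
by rewrite /= modn_small ?prednK.
Qed.

Lemma maxavoid_leq_bigmax (s : Zmod n) : 0 < k ->
  maxavoid k s <= \max_(d <- divisors n) max_coset_count k d * (n %/ d).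
Proof.
move=> k_gt0; apply/bigmax_leqP=> B /(leq_card_avoiding k_gt0)[d].
rewrite card_Zmod => dn /leq_trans; apply.
by apply: leq_bigmax_seq; rewrite -?dvdn_divisors.
Qed.

End ModularSumset.

Local Open Scope ring_scope.

Section DivisorTerm.

Variables k n : nat.
Hypotheses (k_gt0 : (0 < k)%N) (n_gt0 : (0 < n)%N).

Lemma divisor_termE d :
  (0 < d)%N -> divisor_term k n d = (max_coset_count k d * (n %/ d))%N%:Z.
Proof.
move=> d_gt0; rewrite /divisor_term PoszM; congr (_ * _).
rewrite /max_coset_count -divz_nat.
have -> : (d + k - 2)%N%:Z = 1 * k%:Z + (d%:Z - 2) by lia.
have k_neq0 : k%:Z != 0 by rewrite -lt0n.
by rewrite divzMDl // [RHS]addrC.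
Qed.

Lemma max_divisor_termE :
  max_divisor_term k n =
    (\max_(d <- divisors n) max_coset_count k d * (n %/ d))%N%:Z.
Proof.
have Posz_max : {morph Posz : x y / maxn x y >-> Num.max x y}.
  by move=> x y; rewrite /Num.max ltz_nat -fun_if.
rewrite (big_morph Posz Posz_max (erefl _)) /max_divisor_term.
apply: eq_big_seq => d; rewrite -dvdn_divisors // => dn.
exact: divisor_termE (dvdn_gt0 n_gt0 dn).
Qed.

End DivisorTerm.

Theorem corollary3p2 (k n : nat) (hk : (2 <= k)%N) (hn : (0 < n)%N)
  (hkn : coprime k n) (s : Zmod n) :
  (maxavoid k s)%:Z = max_divisor_term k n.
Proof.
have k_gt0 : (0 < k)%N := ltnW hk.
rewrite max_divisor_termE //; congr Posz.
apply/eqP; rewrite eqn_leq maxavoid_leq_bigmax //=.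
apply/bigmax_leqP_seq => d; rewrite -dvdn_divisors // => dn _.
exact: leq_maxavoid_divisor.
Qed.
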